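(* Let $\mathcal{H}$ be a nonzero complex Hilbert space. The pair $\left(C(B(\mathcal{H})^+),\|\cdot\|\right)$ is a normed ordered cone, where $C(B(\mathcal{H})^+)$ is the ordered cone of connections on $B(\mathcal{H})^+$ and $\|\sigma\|=\sup\{\|A\,\sigma\,B\|: A,B\geqslant0,\ \|A\|=\|B\|=1\}$.
   Context: $B(\mathcal{H})$ is the algebra of bounded linear operators on $\mathcal{H}$, $B(\mathcal{H})^+$ its set of positive (semidefinite) operators, $\mathbb{R}^+=[0,\infty)$. A connection on $B(\mathcal{H})^+$ is a binary operation $\sigma: B(\mathcal{H})^+\times B(\mathcal{H})^+\to B(\mathcal{H})^+$ such that for all $A,B,C,D\geqslant 0$: (M1) $A\leqslant C$, $B\leqslant D$ imply $A\,\sigma\,B\leqslant C\,\sigma\,D$; (M2) $C(A\,\sigma\,B)C\leqslant (CAC)\,\sigma\,(CBC)$; (M3) if $A_n\downarrow A$ and $B_n\downarrow B$ in $B(\mathcal{H})^+$ (decreasing sequences converging strongly), then $A_n\,\sigma\,B_n\downarrow A\,\sigma\,B$. The set $C(B(\mathcal{H})^+)$ of connections carries the operations $A\,(\sigma+\eta)\,B=(A\,\sigma\,B)+(A\,\eta\,B)$ and $A\,(k\sigma)\,B=k(A\,\sigma\,B)$ for $k\in\mathbb{R}^+$, with neutral element the zero connection $(A,B)\mapsto0$, and the order $\sigma_1\leqslant\sigma_2$ iff $A\,\sigma_1\,B\leqslant A\,\sigma_2\,B$ for all $A,B\geqslant0$. A normed cone is a cone $C$ (commutative monoid with a compatible scalar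 multiplication by $\mathbb{R}^+$) with a function $\|\cdot\|:C\to\mathbb{R}^+$ such that for $x,y\in C$, $k\in\mathbb{R}^+$: $\|x\|=0\Rightarrow x=0$; $\|kx\|=k\|x\|$; $\|x+y\|\leqslant\|x\|+\|y\|$. A normed ordered cone is an ordered cone (cone with a partial order compatible with the operations) which is also a normed cone such that $x\leqslant y\Rightarrow\|x\|\leqslant\|y\|$. *)

(* Defs.v *)
From HB Require Import structures.
From mathcomp Require Import all_boot all_order all_algebra sesquilinear.
From mathcomp Require Import complex.
From mathcomp Require Import all_classical all_reals all_analysis.

Set Implicit Arguments.
Unset Strict Implicit.
Unset Printing Implicit Defensive.

Import Order.TTheory GRing.Theory Num.Theory.
Import numFieldNormedType.Exports.

Local Open Scope classical_set_scope.
Local Open Scope ring_scope.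
Local Open Scope complex_scope.

(* The inner product is linear in its first argument and conjugate-linear in
   the second one. The norm of a normed module over R[i] takes its values in
   R[i] (in the nonnegative reals), hence the equation below is in R[i]. *)
HB.mixin Record CompleteNormedModule_isHilbert (R : realType) H
    & CompleteNormedModule R[i] H := {
  dotp : {dot H for @Num.conj R[i]} ;
  dotp_norm : forall x : H, dotp x x = `|x| ^+ 2
}.

#[short(type="hilbertType")]
HB.structure Definition Hilbert (R : realType) :=
  {H of CompleteNormedModule R[i] H & CompleteNormedModule_isHilbert R H}.

Section Operators.
Variables (R : realType) (H : hilbertType R).

Definition hnorm (x : H) : R := complex.Re `|x|.

Lemma hnormE (x : H) : `|x| = (hnorm x)%:C.
Proof.
have /ger0_Im := normr_ge0 x.
by rewrite /hnorm; case: `|x| => a b /= ->.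
Qed.

Lemma hnorm_ge0 (x : H) : 0 <= hnorm x.
Proof. by rewrite -ler0c -hnormE. Qed.

Lemma hnormD (x y : H) : hnorm (x + y) <= hnorm x + hnorm y.
Proof. by rewrite -lecR rmorphD /= -!hnormE ler_normD. Qed.

Lemma hnormZ (k : R) (x : H) : hnorm (k%:C *: x) = `|k| * hnorm x.
Proof.
suff : (hnorm (k%:C *: x))%:C = (`|k| * hnorm x)%:C by case.
by rewrite -hnormE normrZ normc_def /= expr0n addr0 sqrtr_sqr rmorphM /= -hnormE.
Qed.

Lemma dotpC (x y : H) : dotp x y = (dotp y x)^*%R.
Proof. by rewrite (hermitian_subproof x y) expr0 mul1r. Qed.

Lemma dotpDl (x y z : H) : dotp (x + y) z = dotp x z + dotp y z.
Proof. exact: linearDl. Qed.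

Lemma dotpZl (k : R[i]) (x z : H) : dotp (k *: x) z = k * dotp x z.
Proof. exact: linearZl_LR. Qed.

Lemma dotpDr (x y z : H) : dotp z (x + y) = dotp z x + dotp z y.
Proof. by rewrite dotpC dotpDl rmorphD /= -(dotpC z x) -(dotpC z y). Qed.

Lemma dotpZr (k : R[i]) (x z : H) : dotp z (k *: x) = k^*%R * dotp z x.
Proof. by rewrite dotpC dotpZl rmorphM /= -dotpC. Qed.

Definition bounded_op (f : H -> H) : Prop :=
  exists M : R, forall x : H, hnorm (f x) <= M * hnorm x.

Definition positive_op (f : H -> H) : Prop := forall x : H, 0 <= dotp (f x) x.

Definition op_le (f g : H -> H) : Prop := positive_op (fun x => g x - f x).

(* B(H) *)
Record bop := Bop { bop_fun :> {linear H -> H} ; bop_bounded : bounded_op bop_fun }.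

(* B(H)^+ *)
Record posop := Posop { pos_bop :> bop ; pos_ge0 : positive_op pos_bop }.

(* The set is bounded above, and it contains 0. *)
Definition opnorm (A : bop) : R :=
  sup [set hnorm (A x) | x in [set x : H | hnorm x <= 1]].

Lemma bounded_op0 : bounded_op (\0 : {linear H -> H}).
Proof. by exists 0 => x; rewrite mul0r /hnorm normr0. Qed.

Definition bop0 : bop := Bop bounded_op0.

Lemma bounded_opD (A B : bop) : bounded_op (A \+ B : {linear H -> H}).
Proof.
have [M hM] := bop_bounded A; have [N hN] := bop_bounded B.
exists (M + N) => x; rewrite mulrDl.
by apply: (le_trans (hnormD _ _)); rewrite lerD.
Qed.

Definition bopD (A B : bop) : bop := Bop (bounded_opD A B).

Lemma bounded_opZ (k : R) (A : bop) : bounded_op (k%:C \*: A : {linear H -> H}).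
Proof.
have [M hM] := bop_bounded A; exists (`|k| * M) => x.
by rewrite /= hnormZ -mulrA ler_wpM2l.
Qed.

Definition bopZ (k : R) (A : bop) : bop := Bop (bounded_opZ k A).

Lemma bounded_opM (A B : bop) : bounded_op (A \o B : {linear H -> H}).
Proof.
have [M hM] := bop_bounded A; have [N hN] := bop_bounded B.
exists (`|M| * N) => x; rewrite /= -mulrA.
apply: (le_trans (hM _)).
apply: (@le_trans _ _ (`|M| * hnorm (B x))).
  by rewrite ler_wpM2r ?hnorm_ge0 ?ler_norm.
by rewrite ler_wpM2l.
Qed.

Definition bopM (A B : bop) : bop := Bop (bounded_opM A B).

Lemma positive_sym (A : posop) (x y : H) : dotp (A x) y = dotp x (A y).
Proof.
have qr (u : H) : (dotp (A u) u)^*%R = dotp (A u) u.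
  by apply/CrealP/ger0_real/pos_ge0.
have cross (u v : H) :
    (dotp (A u) v + dotp (A v) u)^*%R = dotp (A u) v + dotp (A v) u.
  have := qr (u + v); rewrite (linearD A) /= !dotpDl !dotpDr !rmorphD /= !qr.
  set q := dotp (A u) u; set r := dotp (A v) v.
  rewrite -!addrA => /addrI; rewrite !addrA => /addIr; exact.
rewrite [RHS]dotpC; set a := dotp (A x) y; set b := dotp (A y) x.
have := cross x y; have := cross ('i *: x) y.
have -> : A ('i *: x) = 'i *: A x by exact: linearZ.
rewrite !dotpZl !dotpZr !rmorphD !rmorphM /= !conjCK !conjCi -/a -/b.
rewrite !mulNr -!mulrBr addrC.
rewrite -mulrBr => e0 e2; have e1 := mulfI (neq0Ci R[i]) e0.
have e3 : a *+ 2 = b^*%R *+ 2.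
  have -> : a *+ 2 = (a + b) + (a - b) by rewrite addrACA subrr addr0 mulr2n.
  by rewrite -e2 -e1 [a^*%R + _]addrC addrACA subrr addr0 mulr2n.
by apply: (mulIf (x := 2%:R)); rewrite ?pnatr_eq0 // !mulr_natr.
Qed.

Lemma positive_op0 : positive_op bop0.
Proof. by move=> x; rewrite /= dotpC linear0r rmorph0. Qed.

Definition pos0 : posop := Posop positive_op0.

Lemma positive_opD (A B : posop) : positive_op (bopD A B).
Proof. by move=> x; rewrite /= dotpDl addr_ge0 //; apply: pos_ge0. Qed.

Definition posD (A B : posop) : posop := Posop (positive_opD A B).

Lemma positive_opZ (k : {nonneg R}) (A : posop) : positive_op (bopZ k%:num A).
Proof.
by move=> x; rewrite /= dotpZl mulr_ge0 ?ler0c //; apply: pos_ge0.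
Qed.

Definition posZ (k : {nonneg R}) (A : posop) : posop := Posop (positive_opZ k A).

Lemma positive_op_congr (C A : posop) : positive_op (bopM C (bopM A C)).
Proof. by move=> x; rewrite /= positive_sym; apply: pos_ge0. Qed.

(* C A C *)
Definition pos_congr (C A : posop) : posop := Posop (positive_op_congr C A).

Definition decreases_to (A_ : nat -> posop) (A : posop) : Prop :=
  (forall n, op_le (A_ n.+1) (A_ n)) /\
  (forall x : H, A_ n x @[n --> \oo] --> A x).

Record is_connection (s : posop -> posop -> posop) : Prop := IsConnection {
  conn_monotone : forall A B C D : posop,
    op_le A C -> op_le B D -> op_le (s A B) (s C D) ;
  conn_transformer : forall A B C : posop,
    op_le (pos_congr C (s A B)) (s (pos_congr C A) (pos_congr C B)) ;
  conn_continuous : forall (A_ B_ : nat -> posop) (A B : posop),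
    decreases_to A_ A -> decreases_to B_ B ->
    decreases_to (fun n => s (A_ n) (B_ n)) (s A B)
}.

(* C(B(H)^+) *)
Record connection := Connection {
  conn_fun :> posop -> posop -> posop ;
  connP : is_connection conn_fun
}.

Lemma op_le_refl (f : H -> H) : op_le f f.
Proof. by move=> x; rewrite subrr dotpC linear0r rmorph0. Qed.

Lemma op_leD (f f' g g' : H -> H) :
  op_le f f' -> op_le g g' -> op_le (f \+ g) (f' \+ g').
Proof.
by move=> lf lg x; rewrite /= opprD addrACA dotpDl addr_ge0; [|exact: lf|exact: lg].
Qed.

Lemma op_leZ (k : {nonneg R}) (f f' : H -> H) :
  op_le f f' -> op_le (k%:num%:C \*: f) (k%:num%:C \*: f').
Proof.
by move=> lf x; rewrite /= -scalerBr dotpZl mulr_ge0 ?ler0c //; apply: lf.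
Qed.

Lemma is_connection0 : is_connection (fun _ _ => pos0).
Proof.
split=> [*|A B C x|*]; first exact: op_le_refl.
  by rewrite /= linear0; apply: op_le_refl.
by split=> [n|x]; [exact: op_le_refl | exact: cvg_cst].
Qed.

Definition conn0 : connection := Connection is_connection0.

Lemma is_connectionD (s t : connection) :
  is_connection (fun A B => posD (s A B) (t A B)).
Proof.
split=> [A B C D AC BD|A B C x|A_ B_ A B hA hB].
- by apply: op_leD; apply: conn_monotone => //; apply: connP.
- have := op_leD (conn_transformer (connP s) A B C)
                 (conn_transformer (connP t) A B C) x.
  by rewrite /= (linearD C).
- have [ds cs] := conn_continuous (connP s) hA hB.
  have [dt ct] := conn_continuous (connP t) hA hB.
  split=> [n|x]; first by apply: op_leD.
  apply: (cvgD (cs x) (ct x)).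
Qed.

Definition connD (s t : connection) : connection := Connection (is_connectionD s t).

Lemma is_connectionZ (k : {nonneg R}) (s : connection) :
  is_connection (fun A B => posZ k (s A B)).
Proof.
split=> [A B C D AC BD|A B C x|A_ B_ A B hA hB].
- by apply: op_leZ; apply: conn_monotone => //; apply: connP.
- have := op_leZ k (conn_transformer (connP s) A B C) x.
  by rewrite /= (_ : C (k%:num%:C *: _) = k%:num%:C *: C (s A B (C x))) //; exact: linearZ.
- have [ds cs] := conn_continuous (connP s) hA hB.
  split=> [n|x]; first exact: op_leZ.
  exact: cvgZr (cs x).
Qed.

Definition connZ (k : {nonneg R}) (s : connection) : connection :=
  Connection (is_connectionZ k s).

Definition conn_le (s t : connection) : Prop :=
  forall A B : posop, op_le (s A B) (t A B).

Definition conn_norms (s : connection) : set R :=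
  [set r | exists A B : posop, opnorm A = 1 /\ opnorm B = 1 /\ r = opnorm (s A B)].

Definition conn_norm (s : connection) : R := sup (conn_norms s).

End Operators.

Arguments conn0 {R H}.

Section Cones.
Variables (R : realType) (C : Type) (zero : C) (add : C -> C -> C).
Variables (scale : {nonneg R} -> C -> C) (le : C -> C -> Prop) (norm : C -> R).

Record is_cone : Prop := IsCone {
  cone_addA : associative add ;
  cone_addC : commutative add ;
  cone_add0 : left_id zero add ;
  cone_scaleDr : forall k x y, scale k (add x y) = add (scale k x) (scale k y) ;
  cone_scaleDl : forall (k l : {nonneg R}) x,
    scale (k%:num + l%:num)%:nng x = add (scale k x) (scale l x) ;
  cone_scaleA : forall (k l : {nonneg R}) x,
    scale (k%:num * l%:num)%:nng x = scale k (scale l x) ;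
  cone_scale1 : forall x, scale 1%:nng x = x ;
  cone_scale0 : forall x, scale 0%:nng x = zero
}.

Record is_ordered_cone : Prop := IsOrderedCone {
  ordered_cone_cone : is_cone ;
  ordered_cone_refl : forall x, le x x ;
  ordered_cone_anti : forall x y, le x y -> le y x -> x = y ;
  ordered_cone_trans : forall x y z, le x y -> le y z -> le x z ;
  ordered_cone_add : forall x y z, le x y -> le (add x z) (add y z) ;
  ordered_cone_scale : forall k x y, le x y -> le (scale k x) (scale k y)
}.

Record is_normed_cone : Prop := IsNormedCone {
  normed_cone_cone : is_cone ;
  normed_cone_ge0 : forall x, 0 <= norm x ;
  normed_cone_eq0 : forall x, norm x = 0 -> x = zero ;
  normed_cone_scale : forall (k : {nonneg R}) x, norm (scale k x) = k%:num * norm x ;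
  normed_cone_add : forall x y, norm (add x y) <= norm x + norm y
}.

Record is_normed_ordered_cone : Prop := IsNormedOrderedCone {
  normed_ordered_cone_ordered : is_ordered_cone ;
  normed_ordered_cone_normed : is_normed_cone ;
  normed_ordered_cone_le : forall x y, le x y -> norm x <= norm y
}.

End Cones.

(* Main.v *)
(* A positive operator of norm 1 lies below the identity I, so by monotonicity
   the supremum defining the norm is attained at (I, I) and the norm of s is the
   operator norm of s I I. This operator norm is monotone on positive operators,
   by the Cauchy-Schwarz inequality for the form (A x, y). If s I I = 0, the
   transformer inequality with C = a^-1 I gives s (a^2 I) (a^2 I) = 0, and
   every pair of positive operators is dominated by such a scalar pair. *)

Require Import Defs.
From mathcomp Require Import all_boot all_order all_algebra.
From mathcomp Require Import all_classical all_reals all_analysis.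
From mathcomp Require Import complex ring lra.
Import Order.TTheory GRing.Theory Num.Theory.
Import numFieldNormedType.Exports.
Local Open Scope classical_set_scope.
Local Open Scope ring_scope.

Section Operators.
Context {R : realType} {H : hilbertType R}.
Implicit Types (A B C : posop H) (x y : H) (s t : connection H).

(** * Extensionality of operators and connections *)

Lemma bop_ext (f g : bop H) : (forall x, f x = g x) -> f = g.
Proof.
case: f => f bf; case: g => g bg /= fg.
have {fg} : f = g :> (H -> H) by apply: funext.
(* Opening the packed linear maps exposes their proof fields, which proof irrelevance identifies
   once the underlying functions agree. *)
case: f bf => f [[a] [b]] bf; case: g bg => g [[c] [d]] bg /= fg.
move: a b bf c d bg; rewrite fg => a b bf c d bg.
have ac := Prop_irrelevance a c; have bd := Prop_irrelevance b d.
by subst c d; rewrite (Prop_irrelevance bf bg).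
Qed.

Lemma posop_ext A B : (forall x, A x = B x) -> A = B.
Proof.
case: A => A pA; case: B => B pB /= /bop_ext AB; case: _ / AB in pB *.
by rewrite (Prop_irrelevance pA pB).
Qed.

Lemma conn_ext s t : (forall A B x, s A B x = t A B x) -> s = t.
Proof.
case: s => s ps; case: t => t pt /= st.
have {}st : s = t.
  by apply: funext => A; apply: funext => B; apply: posop_ext => x; apply: st.
by case: _ / st in pt *; rewrite (Prop_irrelevance ps pt).
Qed.

(** * Quadratic forms and the Cauchy-Schwarz inequality *)

Lemma dotp_hnorm x : dotp x x = ((hnorm x ^+ 2)%:C)%C.
Proof. by rewrite dotp_norm hnormE rmorphXn. Qed.

Lemma hnorm_eq0 x : hnorm x = 0 -> x = 0.
Proof. by move=> h; apply: normr0_eq0; rewrite hnormE h. Qed.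

(** Positivity makes [dotp (A x) x] real, so the real part loses nothing and the operator order
    becomes a comparison of real numbers. *)
Definition qform A x : R := complex.Re (dotp (A x) x).

Lemma qformE A x : dotp (A x) x = ((qform A x)%:C)%C.
Proof.
have /ger0_Im := pos_ge0 A x.
by rewrite /qform; case: (dotp _ _) => a b /= ->.
Qed.

Lemma qform_ge0 A x : 0 <= qform A x.
Proof. by rewrite -ler0c -qformE pos_ge0. Qed.

Lemma op_leP A B : op_le A B <-> forall x, qform A x <= qform B x.
Proof.
have E x : dotp (B x - A x) x = ((qform B x - qform A x)%:C)%C.
  by rewrite linearBl /= !qformE rmorphB.
by split=> h x; have := h x; rewrite E ler0c subr_ge0.
Qed.

(** For real [t] the form at [x - t y] is a nonnegative quadratic polynomial in [t], so its
    discriminant is nonpositive. *)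
Lemma qform_cauchy_schwarz A x y :
  complex.Re (dotp (A x) y) ^+ 2 <= qform A x * qform A y.
Proof.
set r := complex.Re _.
have quad (t : R) : 0 <= qform A x - 2 * t * r + t ^+ 2 * qform A y.
  have := qform_ge0 A (x - (t%:C)%C *: y).
  suff -> : qform A (x - (t%:C)%C *: y) =
     qform A x - 2 * t * r + t ^+ 2 * qform A y by [].
  have EA : A (x - (t%:C)%C *: y) = A x + (- (t%:C)%C) *: A y.
    by rewrite linearB linearZ scaleNr.
  rewrite /qform EA -scaleNr !dotpDl !dotpDr !dotpZl !dotpZr.
  have -> : dotp (A y) x = (dotp (A x) y)^*%R by rewrite positive_sym -dotpC.
  rewrite /r -!/(qform _ _) !qformE.
  by case: (dotp (A x) y) => a b /=; simpc => /=; ring.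
have := qform_ge0 A y; rewrite le_eqVlt => /predU1P[y0|ypos]; last first.
  (* The minimiser of the polynomial. *)
  have := quad (r / qform A y).
  have -> : qform A x - 2 * (r / qform A y) * r + (r / qform A y) ^+ 2 * qform A y
    = (qform A x * qform A y - r ^+ 2) / qform A y by field; rewrite gt_eqF.
  by rewrite pmulr_lge0 ?invr_gt0 // subr_ge0.
rewrite -y0 mulr0.
have [->|r0] := eqVneq r 0; first by rewrite expr0n.
(* Here the polynomial is affine with nonzero slope; at this [t] it takes the negative value
   [- qform A x - 2]. *)
have := quad ((qform A x + 1) / r); rewrite -y0.
have -> : qform A x - 2 * ((qform A x + 1) / r) * r + ((qform A x + 1) / r) ^+ 2 * 0
   = - qform A x - 2 by field.
have := qform_ge0 A x; lra.
Qed.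

Lemma bounded_op_scalar (a : R) : bounded_op ((a%:C)%C \*: idfun : {linear H -> H}).
Proof. by exists `|a| => x; rewrite /= hnormZ. Qed.

Lemma positive_op_scalar (a : {nonneg R}) : positive_op (Bop (bounded_op_scalar a%:num)).
Proof. by move=> x; rewrite /= dotpZl dotp_hnorm -rmorphM /= ler0c mulr_ge0 ?sqr_ge0. Qed.

Definition pos_scalar (a : {nonneg R}) : posop H := Posop (positive_op_scalar a).

Definition pos1 : posop H := pos_scalar 1%:nng.

Lemma qform_scalar (a : {nonneg R}) x :
  qform (pos_scalar a) x = a%:num * hnorm x ^+ 2.
Proof. by rewrite /qform /= dotpZl dotp_hnorm -rmorphM. Qed.

(** The form of the identity operator is the inner product, so this is the previous inequality at
    [pos1]. *)
Lemma re_dotp_le x y : complex.Re (dotp x y) <= hnorm x * hnorm y.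
Proof.
have := qform_cauchy_schwarz pos1 x y.
rewrite !qform_scalar /= scale1r !mul1r -exprMn => h.
apply: le_trans (ler_norm _) _.
by rewrite -ler_sqr ?nnegrE ?mulr_ge0 ?hnorm_ge0 // real_normK ?num_real.
Qed.

(** * The operator norm and its behaviour under the order *)

Lemma has_sup_opnorm (f : bop H) :
  has_sup [set hnorm (f x) | x in [set x : H | hnorm x <= 1]].
Proof.
split; first by exists (hnorm (f 0)), 0 => //=; rewrite /hnorm normr0.
have [M hM] := bop_bounded f; exists `|M| => _ [x /= x1 <-].
apply: (le_trans (hM x)); apply: (@le_trans _ _ (`|M| * hnorm x)).
  by rewrite ler_wpM2r ?hnorm_ge0 ?ler_norm.
by rewrite -[leRHS]mulr1 ler_wpM2l.
Qed.

Lemma hnorm_opnorm (f : bop H) x : hnorm (f x) <= opnorm f * hnorm x.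
Proof.
have := hnorm_ge0 x; rewrite le_eqVlt => /predU1P[x0|xpos].
  by rewrite (hnorm_eq0 _ (esym x0)) linear0 /hnorm normr0 /= mulr0.
rewrite -ler_pdivrMr //.
have -> : hnorm (f x) / hnorm x = hnorm (f (((hnorm x)^-1%:C)%C *: x)).
  by rewrite linearZ /= hnormZ ger0_norm ?invr_ge0 ?hnorm_ge0 // mulrC.
apply: (sup_upper_bound (has_sup_opnorm f)); exists (((hnorm x)^-1%:C)%C *: x) => //=.
by rewrite hnormZ ger0_norm ?invr_ge0 ?hnorm_ge0 // mulVf ?gt_eqF.
Qed.

Lemma opnorm_le (f : bop H) (M : R) : 0 <= M ->
  (forall x, hnorm (f x) <= M * hnorm x) -> opnorm f <= M.
Proof.
move=> M0 hM; apply: ge_sup; first by have [] := has_sup_opnorm f.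
move=> _ [x /= x1 <-]; apply: (le_trans (hM x)).
by rewrite -[leRHS]mulr1 ler_wpM2l.
Qed.

Lemma opnorm_ge0 (f : bop H) : 0 <= opnorm f.
Proof.
apply: le_trans (hnorm_ge0 (f 0)) _.
by apply: (sup_upper_bound (has_sup_opnorm f)); exists 0 => //=; rewrite /hnorm normr0.
Qed.

Lemma opnormD (f g : bop H) : opnorm (bopD f g) <= opnorm f + opnorm g.
Proof.
apply: opnorm_le => [|x]; first by rewrite addr_ge0 ?opnorm_ge0.
by rewrite mulrDl /=; apply: (le_trans (Defs.hnormD _ _)); rewrite lerD ?hnorm_opnorm.
Qed.

Lemma opnormZ_le (k : R) (f : bop H) : opnorm (bopZ k f) <= `|k| * opnorm f.
Proof.
apply: opnorm_le => [|x]; first by rewrite mulr_ge0 ?opnorm_ge0.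
by rewrite /= hnormZ -mulrA ler_wpM2l ?hnorm_opnorm.
Qed.

Lemma opnormZ (k : R) (f : bop H) : opnorm (bopZ k f) = `|k| * opnorm f.
Proof.
apply/le_anti; rewrite opnormZ_le /=.
have [->|k0] := eqVneq k 0; first by rewrite normr0 mul0r opnorm_ge0.
(* The reverse inequality is the one-sided bound applied to [k^-1] and [bopZ k f]. *)
have {1}-> : f = bopZ k^-1 (bopZ k f).
  by apply: bop_ext => x /=; rewrite scalerA -rmorphM /= mulVf // scale1r.
rewrite -ler_pdivlMl ?normr_gt0 //.
by apply: (le_trans (opnormZ_le _ _)); rewrite normfV.
Qed.

Lemma opnorm_eq0 A : opnorm A = 0 -> forall x, A x = 0.
Proof.
move=> A0 x; apply: hnorm_eq0; apply/le_anti; rewrite hnorm_ge0 andbT.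
by have := hnorm_opnorm A x; rewrite A0 mul0r.
Qed.

Lemma qform_le A x : qform A x <= opnorm A * hnorm x ^+ 2.
Proof.
apply: (le_trans (re_dotp_le _ _)).
by rewrite expr2 mulrA ler_wpM2r ?hnorm_ge0 ?hnorm_opnorm.
Qed.

(** Cauchy-Schwarz at [y = A x]: it turns bounds on the form into bounds on the vector [A x]. *)
Lemma hnorm_qform A x : hnorm (A x) ^+ 2 ^+ 2 <= qform A x * qform A (A x).
Proof.
have := qform_cauchy_schwarz A x (A x).
by rewrite dotp_hnorm.
Qed.

(** In [hnorm_qform] both factors are bounded through the form of [B]; cancelling [hnorm (A x) ^+ 2]
    leaves the square of the desired bound. *)
Lemma opnorm_mono A B : op_le A B -> opnorm A <= opnorm B.
Proof.
move=> /op_leP AB; apply: opnorm_le => [|x]; first exact: opnorm_ge0.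
have [->|n0] := eqVneq (hnorm (A x)) 0.
  by rewrite mulr_ge0 ?opnorm_ge0 ?hnorm_ge0.
have npos : 0 < hnorm (A x) by rewrite lt_neqAle eq_sym n0 hnorm_ge0.
have h : hnorm (A x) ^+ 2 ^+ 2 <=
    (opnorm B * hnorm x ^+ 2) * (opnorm B * hnorm (A x) ^+ 2).
  apply: (le_trans (hnorm_qform A x)).
  by apply: ler_pM; rewrite ?qform_ge0 //; apply: (le_trans (AB _)); apply: qform_le.
rewrite -ler_sqr ?nnegrE ?mulr_ge0 ?opnorm_ge0 ?hnorm_ge0 //.
rewrite -(ler_pM2r (exprn_gt0 2 npos)) -expr2.
by apply: (le_trans h); rewrite le_eqVlt; apply/predU1P; left; ring.
Qed.

(* Cauchy-Schwarz for the positive operator B - A: its quadratic form vanishes,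
   hence so does the operator. *)
Lemma op_le_anti A B : op_le A B -> op_le B A -> A = B.
Proof.
move=> AB BA; apply: posop_ext => x.
(* [bopZ] accepts the scalar [-1], so [B - A] is a bounded operator before its positivity is
   known. *)
have pD : positive_op (bopD B (bopZ (-1) A)).
  by move=> y /=; rewrite rmorphN1 scaleN1r; apply: AB.
have D0 : qform (Posop pD) x = 0.
  rewrite /qform /= rmorphN1 scaleN1r linearBl /= !qformE.
  move/op_leP: AB => /(_ x) AB; move/op_leP: BA => /(_ x) BA.
  by rewrite -rmorphB /=; apply/eqP; rewrite subr_eq0 eq_le AB BA.
have := hnorm_qform (Posop pD) x; rewrite D0 mul0r -exprM /= rmorphN1 scaleN1r.
rewrite real_exprn_even_le0 ?num_real //= => /eqP /hnorm_eq0 /eqP.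
by rewrite subr_eq0 => /eqP.
Qed.

Lemma op_le_trans A B C : op_le A B -> op_le B C -> op_le A C.
Proof.
move=> /op_leP AB /op_leP BC; apply/op_leP => x.
exact: le_trans (AB x) (BC x).
Qed.

Lemma op_le_scalar A (a : {nonneg R}) : opnorm A <= a%:num -> op_le A (pos_scalar a).
Proof.
move=> Aa; apply/op_leP => x; rewrite qform_scalar; apply: (le_trans (qform_le _ _)).
by rewrite ler_wpM2r ?sqr_ge0.
Qed.

(** A nonzero vector is essential: on the zero space every operator has norm 0, and [conn_norms]
    would be empty. *)
Lemma opnorm_scalar1 : (exists x : H, x != 0) -> opnorm pos1 = 1.
Proof.
move=> [x x0]; apply/le_anti/andP; split.
  by apply: opnorm_le => // y; rewrite /= scale1r mul1r.
have xpos : 0 < hnorm x.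
  rewrite lt_neqAle hnorm_ge0 andbT eq_sym.
  by apply: contraNneq x0 => /hnorm_eq0 ->.
have := hnorm_opnorm pos1 x.
by rewrite /= scale1r ler_pMl.
Qed.

(** * The norm of a connection *)

Lemma conn_norms_max s : (exists x : H, x != 0) ->
  let m := opnorm (s pos1 pos1) in
  conn_norms s m /\ ubound (conn_norms s) m.
Proof.
move=> H0 m; split.
  by exists pos1, pos1; rewrite opnorm_scalar1.
move=> _ [A [B [A1 [B1 ->]]]]; apply: opnorm_mono.
by apply: (conn_monotone (connP s)); apply: op_le_scalar; rewrite ?A1 ?B1.
Qed.

Lemma conn_norms_has_sup s : (exists x : H, x != 0) -> has_sup (conn_norms s).
Proof. by move=> /(conn_norms_max s)[m ub]; split; exists (opnorm (s pos1 pos1)). Qed.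

Lemma conn_normE s : (exists x : H, x != 0) ->
  conn_norm s = opnorm (s pos1 pos1).
Proof.
move=> H0; have [m ub] := conn_norms_max s H0; apply/le_anti/andP; split.
  by apply: ge_sup => //; exists (opnorm (s pos1 pos1)).
exact: sup_upper_bound (conn_norms_has_sup s H0) _ m.
Qed.

Lemma conn_eq0 s :
  opnorm (s pos1 pos1) = 0 -> s = conn0.
Proof.
move=> s0; apply: conn_ext => A B x /=.
(* The summand 1 makes [a] invertible and gives [a <= a * a], so that [S] dominates both [A] and
   [B]. *)
pose a := 1 + opnorm A + opnorm B.
have a1 : 1 <= a by rewrite /a -addrA lerDl addr_ge0 ?opnorm_ge0.
have a_gt0 : 0 < a := lt_le_trans ltr01 a1.
have a0 : a != 0 by rewrite gt_eqF.
have aV_ge0 : 0 <= a^-1 by rewrite invr_ge0 ltW.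
pose S := pos_scalar (NngNum (mulr_ge0 (ltW a_gt0) (ltW a_gt0))).
pose C := pos_scalar (NngNum aV_ge0).
have aa : a <= a * a by rewrite ler_peMl // ltW.
(* [C S C] is in fact the identity; the inequality is the form that monotonicity takes. *)
have CSC : op_le (pos_congr C S) pos1.
  move=> y /=; rewrite !scalerA -!rmorphM /= mulKf // mulfV //.
  by rewrite subrr dotpC linear0r rmorph0.
have sSS : op_le (pos_congr C (s S S)) (s pos1 pos1).
  apply: op_le_trans (conn_transformer (connP s) S S C) _.
  by apply: (conn_monotone (connP s)).
have CsC : forall y, pos_congr C (s S S) y = 0.
  apply: opnorm_eq0; apply/le_anti; rewrite opnorm_ge0 andbT -s0.
  exact: opnorm_mono.
have SS0 y : s S S y = 0.
  have := CsC y; rewrite /= linearZ /= scalerA -rmorphM /= => /eqP.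
  (* The complex zero is written as an embedded real, so that injectivity of the embedding cancels
     the nonzero scalar [a^-1]. *)
  rewrite scaler_eq0 -[0]/((0 : R)%:C)%C => /orP[|/eqP //].
  by rewrite (inj_eq (@complexI R)) mulf_eq0 invr_eq0 (negbTE a0).
apply: opnorm_eq0; apply/le_anti; rewrite opnorm_ge0 andbT.
apply: (@le_trans _ _ (opnorm (s S S))); last first.
  by apply: opnorm_le => // y; rewrite SS0 /hnorm normr0 mul0r.
apply/opnorm_mono/(conn_monotone (connP s)); apply: op_le_scalar; apply: le_trans aa; rewrite /a.
  by rewrite addrAC lerDr addr_ge0 ?opnorm_ge0.
by rewrite lerDr addr_ge0 ?opnorm_ge0.
Qed.

(** * Cone and order axioms, checked pointwise *)

Lemma connection_cone : is_cone (@conn0 R H) (@connD R H) (@connZ R H).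
Proof.
split=> [s t u|s t|s|k s t|k l s|k l s|s|s]; apply: conn_ext => A B x /=.
- by rewrite addrA.
- by rewrite addrC.
- by rewrite add0r.
- by rewrite scalerDr.
- by rewrite rmorphD scalerDl.
- by rewrite rmorphM scalerA.
- by rewrite scale1r.
- by rewrite scale0r.
Qed.

Lemma connection_ordered_cone :
  is_ordered_cone (@conn0 R H) (@connD R H) (@connZ R H) (@conn_le R H).
Proof.
split=> [|s A B|s t st ts|s t u st tu A B|s t u st A B|k s t st A B].
- exact: connection_cone.
- exact: op_le_refl.
- by apply: conn_ext => A B x; rewrite (op_le_anti _ _ (st A B) (ts A B)).
- exact: op_le_trans (st A B) (tu A B).
- by apply: op_leD => //; apply: op_le_refl.
- exact: op_leZ.
Qed.

End Operators.

(** The first conjunct certifies that [conn_norm] is a genuine supremum and not the default value of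
    [sup]. *)
Theorem proposition2p3 (R : realType) (H : hilbertType R)
    (H_neq0 : exists x : H, x != 0) :
  (forall s : connection H, has_sup (conn_norms s)) /\
  is_normed_ordered_cone (@conn0 R H) (@connD R H) (@connZ R H)
    (@conn_le R H) (@conn_norm R H).
Proof.
split=> [s|]; first exact: conn_norms_has_sup.
split=> [||s t st]; first exact: connection_ordered_cone.
  split=> [|s|s|k s|s t].
  - exact: connection_cone.
  - by rewrite conn_normE // opnorm_ge0.
  - by rewrite conn_normE //; apply: conn_eq0.
  - by rewrite !conn_normE // opnormZ ger0_norm.
  - by rewrite !conn_normE // opnormD.
by rewrite !conn_normE //; apply: opnorm_mono.
Qed.
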